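(* Let $T$ be a Taimanov semigroup. Then every shift-continuous $T_1$-topology $\tau$ on $T$ is discrete.
   Context: A semigroup $T$ is called a Taimanov semigroup if it contains two distinct elements $0_T,\infty_T$ such that for any $x,y\in T$: $x\cdot y=\infty_T$ if $x\ne y$ and $x,y\in T\setminus\{0_T,\infty_T\}$; and $x\cdot y=0_T$ if $x=y$ or $\{x,y\}\cap\{0_T,\infty_T\}\neq\emptyset$. No finiteness or infiniteness of $T$ is assumed. A topology on a semigroup $S$ is shift-continuous if for every $a\in S$ the left shift $S\to S$, $x\mapsto ax$, and the right shift $S\to S$, $x\mapsto xa$, are continuous. A $T_1$-topology is a topology in which all singletons are closed. *)

(* Defs.v *)
From HB Require Import structures.
From mathcomp Require Import all_boot.
From mathcomp Require Import boolp classical_sets topology.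

Set Implicit Arguments.
Unset Strict Implicit.
Unset Printing Implicit Defensive.

Local Open Scope classical_set_scope.
Local Open Scope group_scope.

(* A semigroup together with a topology on its carrier; no compatibility
   between the two is required. *)
#[short(type="preTopologicalSemigroupType")]
HB.structure Definition PreTopologicalSemigroup :=
  {T of Topological T & Semigroup T}.

Definition taimanov_semigroup (T : semigroupType) : Prop :=
  exists zero infty : T, [/\ zero <> infty,
    (forall x y : T, x <> y ->
       (~` [set zero; infty]) x -> (~` [set zero; infty]) y -> x * y = infty) &
    (forall x y : T, x = y \/ [set x; y] `&` [set zero; infty] !=set0 ->
       x * y = zero)].

Definition shift_continuous (T : preTopologicalSemigroupType) : Prop :=
  forall a : T, continuous (fun x : T => a * x) /\
                continuous (fun x : T => x * a).

Definition discrete_space (T : topologicalType) : Prop :=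
  forall A : set T, open A.

(* The right-hand side is the axiom of [discreteTopologicalType]. *)
Lemma discrete_space_nbhsE (T : topologicalType) :
  discrete_space T <-> @nbhs T T = principal_filter.
Proof.
split=> [dT|nbhsE A].
  apply/funext => x; apply/seteqP; split=> A.
    by move=> /nbhs_singleton Ax; exact/principal_filterP.
  by move=> /principal_filterP Ax; exact: open_nbhs_nbhs.
by rewrite openE => x Ax; rewrite /interior nbhsE; exact/principal_filterP.
Qed.

(* Main.v *)
(** For $a \notin \{0_T,\infty_T\}$, the preimage of the open set
    $T\setminus\{\infty_T\}$ under $x \mapsto ax$ is $\{a,0_T,\infty_T\}$.
    Hence every point has a finite open neighbourhood (all of $T$ when
    $T=\{0_T,\infty_T\}$), and a $T_1$-space with this property is discrete. *)
Require Import Defs.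
From mathcomp Require Import all_boot classical_sets topology.
From mathcomp Require Import boolp cardinality.

Local Open Scope classical_set_scope.
Local Open Scope group_scope.

(** In a $T_1$-space finite sets are closed, so removing the finite set [U \ x] from the open set
    [U] leaves [[set x]] open; every set is a union of singletons. *)
Lemma locally_finite_accessible_discrete (T : topologicalType) :
  accessible_space T ->
  (forall x : T, exists U : set T, [/\ open U, finite_set U & U x]) ->
  discrete_space T.
Proof.
move=> T1 finU A.
have open1 (x : T) : open [set x].
  have [U [oU fU Ux]] := finU x.
  suff -> : [set x] = U `&` ~` (U `\ x).
    apply: openI => //; apply: closed_openC.
    by apply: (accessible_finite_set_closed.1 T1); exact: finite_setD.
  apply/seteqP; split=> [y -> |y [Uy nUy]]; first by split=> // -[_]; apply.
  by apply: contrapT => yx; apply: nUy.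
by rewrite -[A]image_id -bigcup_imset1; apply: bigcup_open => x _.
Qed.

Lemma taimanov_open3 (T : preTopologicalSemigroupType) (zero infty a : T) :
  zero <> infty ->
  (forall x y : T, x <> y ->
     (~` [set zero; infty]) x -> (~` [set zero; infty]) y -> x * y = infty) ->
  (forall x y : T, x = y \/ [set x; y] `&` [set zero; infty] !=set0 ->
     x * y = zero) ->
  shift_continuous T -> accessible_space T ->
  (~` [set zero; infty]) a -> open [set a; zero; infty].
Proof.
move=> zi mulE mul0 shiftT T1 aX.
suff -> : [set a; zero; infty] = (fun x => a * x) @^-1` (~` [set infty]).
  apply: open_comp => [x _|]; first exact: (shiftT a).1.
  exact/closed_openC/accessible_closed_set1.
apply/seteqP; split=> x /=.
  (* At each of the three points the product with [a] is [zero], so [a * x = infty] would identify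
     [zero] with [infty]. *)
  move=> xE axi; apply: zi; rewrite -axi; apply/esym/mul0.
  case: xE => [[->|->]|->]; first by left.
    by right; exists zero; split; [right|left].
  by right; exists infty; split; right.
move=> axi; apply: contrapT => nx; apply: axi; apply: mulE => //.
- by move=> ax; apply: nx; left; left.
- by move=> [xz|xi]; apply: nx; [left; right|right].
Qed.

Theorem proposition2 (T : preTopologicalSemigroupType) :
  taimanov_semigroup T -> shift_continuous T -> accessible_space T ->
  discrete_space T.
Proof.
move=> [zero [infty [zi mulE mul0]]] shiftT T1.
apply: locally_finite_accessible_discrete => // x.
have open3 a := @taimanov_open3 T zero infty a zi mulE mul0 shiftT T1.
have fin3 (a : T) : finite_set [set a; zero; infty].
  by rewrite !finite_setU; do !split; exact: finite_set1.
have [xX|/contrapT xE] := pselect ((~` [set zero; infty]) x).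
  by exists [set x; zero; infty]; split=> //; [exact: open3|left; left].
(* Here [x] is [zero] or [infty], and both lie in [[set a; zero; infty]] whatever [a] is, so any [a]
   outside [[set zero; infty]] will do. *)
have [[a aX]|noX] := pselect (exists a, (~` [set zero; infty]) a).
  exists [set a; zero; infty]; split=> //; first exact: open3.
  by case: xE => ->; [left; right|right].
exists setT; split=> //; first exact: openT.
(* Taking [zero] for [a] collapses the triple to [[set zero; infty]], which is now the whole
   space. *)
apply: sub_finite_set (fin3 zero) => y _.
apply: contrapT => ny; apply: noX; exists y => -[yz|yi]; apply: ny.
  by left; left.
by right.
Qed.
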